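(* Let $w(i,j)=\dfrac{i+j}{i^2}$ for integers $1\le i<j$, and let $a$ be the weight-minimizing jump sequence for this weight (as defined in the context). Then $\mathcal{A}_\infty$ is exactly the set of Pell numbers $\{1,2,5,12,29,70,169,\ldots\}$, i.e. $\{p_n : n\ge 1\}$ where $p_1=1$, $p_2=2$ and $p_n=2p_{n-1}+p_{n-2}$ for $n\ge 3$.
   Context: A jump sequence is an integer sequence $a(n)$, $n\ge 1$, with $a(1)=1$ and $1\le a(n)<n$ for $n\ge2$. Write $a^0(n)=n$ and $a^k(n)=a(a^{k-1}(n))$. Given a weight function assigning to integers $1\le i<j$ a real weight $w(i,j)$, the weight-minimizing jump sequence is constructed as follows: $a(1)=1$, $b(1)=0$, and for $n\ge2$, $b(n)=\min_{1\le k\le n-1}\big(w(k,n)+b(k)\big)$ and $a(n)$ is the smallest $k\in\{1,\dots,n-1\}$ achieving this minimum. For $k\ge0$ let $\mathcal{A}_k=\{a^k(m): m\ge1\}$, and let $\mathcal{A}_\infty=\bigcap_{k\ge0}\mathcal{A}_k$. *)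

(* Defs.v *)
From HB Require Import structures.
From mathcomp Require Import all_boot all_order all_algebra.
From mathcomp Require Import all_classical all_reals.

Set Implicit Arguments.
Unset Strict Implicit.
Unset Printing Implicit Defensive.

Import Order.TTheory GRing.Theory Num.Theory.
Local Open Scope classical_set_scope.
Local Open Scope ring_scope.

(* Sequences indexed by n >= 1 are functions on nat whose value at 0 is
   irrelevant: no definition below looks at w, a or b at index 0. *)

Definition is_min_on (R : realType) (D : set nat) (f : nat -> R) (m : R) :=
  (exists2 k, D k & m = f k) /\ (forall k, D k -> m <= f k).

(* [weight_minimizing w a b]: a is the weight-minimizing jump sequence for w,
   and b is the auxiliary sequence of minimal weights. *)
Definition weight_minimizing (R : realType) (w : nat -> nat -> R)
    (a : nat -> nat) (b : nat -> R) : Prop :=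
  [/\ a 1%N = 1%N, b 1%N = 0 &
    forall n, (2 <= n)%N ->
      let D := [set k | (1 <= k <= n - 1)%N] in
      let c := fun k => w k n + b k in
      [/\ is_min_on D c (b n), D (a n), c (a n) = b n &
          forall k, D k -> c k = b n -> (a n <= k)%N]].

Definition jump_image (a : nat -> nat) (k : nat) : set nat :=
  [set iter k a m | m in [set m | (1 <= m)%N]].

Definition jump_core (a : nat -> nat) : set nat :=
  \bigcap_(k in setT) jump_image a k.

Definition pell_weight (R : realType) (i j : nat) : R :=
  (i%:R + j%:R) / i%:R ^+ 2.

(* The value pell 0 = 0 extends the recurrence one step down from
   pell 1 = 1 and pell 2 = 2. *)
Fixpoint pell (n : nat) : nat :=
  match n with
  | 0 => 0
  | 1 => 1
  | (m.+1 as m1).+1 => 2 * pell m1 + pell m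
  end%N.

Example pell_values : map pell (iota 1 7) = [:: 1; 2; 5; 12; 29; 70; 169]%N.
Proof. by []. Qed.

(* The construction always succeeds, so statements quantifying over all a, b
   with [weight_minimizing w a b] are not vacuous. *)
Section Existence.
Variables (R : realType) (w : nat -> nat -> R).

Let good (b : nat -> R) n k :=
  (0 < k)%N && all (fun j => (0 < j)%N ==> (w k n + b k <= w j n + b j))
                   (iota 0 n).

Let argm b n := find (good b n) (iota 0 n).

Let step n (f : nat -> nat * R) m :=
  if m == n then
    let k := argm (fun i => (f i).2) n in (k, w k n + (f k).2)
  else f m.

Fixpoint wm_approx n : nat -> nat * R :=
  match n with
  | 0 => fun=> (1%N, 0)
  | n'.+1 => if n' is 0 then fun=> (1%N, 0) else step n (wm_approx n')
  end.

Let wm_stable n m : (0 < m <= n)%N -> wm_approx n m = wm_approx m m.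
Proof.
elim: n => [|[|n] IH]; first by case: m.
  by case: m {IH} => [|[|m]].
case/andP=> m0; rewrite leq_eqVlt => /orP[/eqP->//|mn].
have -> : wm_approx n.+2 m = step n.+2 (wm_approx n.+1) m by [].
by rewrite /step ltn_eqF // IH ?m0.
Qed.

Let good_ex b n : (2 <= n)%N -> has (good b n) (iota 0 n).
Proof.
case: n => [|[|n]]// _; set c := fun k => w k n.+2 + b k.
have [k _ kmin] := @arg_minP _ _ 'I_n.+1 ord0 predT (fun i => c i.+1) isT.
apply/hasP; exists k.+1; first by rewrite mem_iota /= add0n ltnS.
apply/allP => -[|j]; rewrite mem_iota //= add0n ltnS => jn.
exact: (kmin (Ordinal jn)).
Qed.

Lemma weight_minimizing_exists : exists a b, weight_minimizing w a b.
Proof.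
exists (fun n => (wm_approx n n).1), (fun n => (wm_approx n n).2).
split=> // n n2 D c.
case: n => [|[|n]]// in n2 D c *.
set b := fun i => (wm_approx n.+1 i).2.
have DE k : D k = (0 < k <= n.+1)%N :> Prop by rewrite /D /mkset subn1.
have cE k : D k -> c k = w k n.+2 + b k.
  by rewrite DE => kn; rewrite /c /b wm_stable.
have wE : wm_approx n.+2 n.+2 = (argm b n.+2, w (argm b n.+2) n.+2 + b (argm b n.+2)).
  have -> : wm_approx n.+2 n.+2 = step n.+2 (wm_approx n.+1) n.+2 by [].
  by rewrite /step eqxx.
rewrite wE /=; set k := argm b n.+2.
have h := good_ex b n2.
have kn : (k < n.+2)%N by move: h; rewrite has_find size_iota.
have := nth_find 0%N h; rewrite -/(argm b n.+2) -/k nth_iota // add0n.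
move=> /andP[k0 /allP kmin].
have Dk : D k by rewrite DE k0.
have le j : D j -> w k n.+2 + b k <= c j.
  move=> Dj; rewrite cE //; move: Dj; rewrite DE => /andP[j0 jn].
  by have := kmin j; rewrite mem_iota /= add0n ltnS jn j0 => /(_ isT).
split=> //; first by split=> //; exists k => //; rewrite cE.
  by rewrite cE.
move=> j Dj cj; rewrite leqNgt; apply/negP => jk.
have := before_find 0%N jk; rewrite nth_iota ?(ltn_trans jk) // add0n.
move/negP; apply; rewrite /good.
move: (Dj); rewrite DE => /andP[-> _]; rewrite andTb.
by apply/allP => i /kmin; rewrite -(cE j) // cj.
Qed.

End Existence.

(* Main.v *)
(** Let r = 1 + sqrt 2, so r^2 = 2 r + 1.  Completing a square gives
      w(i, j) = r^2 / i - r^2 / j + (j - r i)^2 / (i^2 j),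
    so after telescoping, a path from 1 to m costs r^2 - r^2 / m plus the sum of
    the defects (j - r i)^2 / (i^2 j) of its steps.  Minimizing jumps therefore
    minimize the total defect.  On Pell numbers p_(n+1) - r p_n = (2 - r)^n, so
    the total defect of the Pell path from p_n onwards is at most 10/9 of its
    first step, while any step from p_n to an integer other than p_(n+1) already
    costs more than that.  So an optimal path that leaves the Pell numbers stays
    above the Pell path by a fixed amount, which cannot persist for arbitrarily
    large end points m, reachable at a further cost of at most 6 / m from the
    Pell number just below m. *)
Require Import Defs.
From mathcomp Require Import all_boot all_order all_algebra.
From mathcomp Require Import all_classical all_reals.
From mathcomp Require Import ring lra zify.
Import Order.TTheory GRing.Theory Num.Theory.
Local Open Scope classical_set_scope.
Local Open Scope ring_scope.

(** * Growth of the Pell numbers *)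

Lemma pellSS n : pell n.+2 = (2 * pell n.+1 + pell n)%N.
Proof. by []. Qed.

Lemma pell_ltS n : (pell n < pell n.+1)%N.
Proof. by elim: n => // n IH; rewrite pellSS; lia. Qed.

Lemma pell_leS3 n : (0 < n)%N -> (pell n.+1 <= 3 * pell n)%N.
Proof. by case: n => // n _; rewrite pellSS; have := pell_ltS n; lia. Qed.

Lemma pell_geS2 n : (2 * pell n <= pell n.+1)%N.
Proof. by case: n => // n; rewrite pellSS leq_addr. Qed.

Lemma leq_pell : {mono pell : m n / (m <= n)%N}.
Proof. exact/leq_mono/(homo_ltn ltn_trans)/pell_ltS. Qed.

Lemma ltn_pell : {mono pell : m n / (m < n)%N}.
Proof. by move=> m n; rewrite !ltnNge leq_pell. Qed.

Lemma pell_inj : injective pell.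
Proof. exact: incn_inj leq_pell. Qed.

Lemma pell_gt0 n : (0 < n)%N -> (0 < pell n)%N.
Proof. by rewrite -[X in (X < pell _)%N]/(pell 0) ltn_pell. Qed.

Lemma leq_id_pell n : (n <= pell n)%N.
Proof. by elim: n => // n IH; have := pell_ltS n; lia. Qed.

Lemma pell_bracket m : (2 <= m)%N ->
  exists l, [/\ (0 < l)%N, (pell l < m)%N & (m <= pell l.+1)%N].
Proof.
move=> m2; have ex : exists l, (m <= pell l.+1)%N.
  by exists m; apply: leq_trans (leq_id_pell m) (ltnW (pell_ltS m)).
have lP := ex_minnP ex; case: lP => -[|l] ml lmin; first by move: ml => /=; lia.
exists l.+1; split=> //; rewrite ltnNge; apply/negP => /lmin.
by rewrite ltnn.
Qed.

(** * Identities and bounds for the defect of a single step *)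

Section Defect.
Variable R : realType.

Definition silver : R := 1 + Num.sqrt 2.
Local Notation r := silver.

Lemma silver_sq : r ^+ 2 = 2 * r + 1.
Proof.
have := @sqr_sqrtr R 2 (ler0n _ _); rewrite /r; set s := Num.sqrt 2 => hs.
by nra.
Qed.

Lemma silver_bounds : 241 / 100 < r < 242 / 100.
Proof.
have := @sqr_sqrtr R 2 (ler0n _ _); have := sqrtr_ge0 (2 : R).
by rewrite /r; set s := Num.sqrt 2 => s0 hs; apply/andP; split; nra.
Qed.

Definition defect (i j : nat) : R :=
  (j%:R - r * i%:R) ^+ 2 / (i%:R ^+ 2 * j%:R).

Lemma defect_ge0 i j : 0 <= defect i j.
Proof. by rewrite divr_ge0 ?sqr_ge0 // mulr_ge0 ?sqr_ge0. Qed.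

Lemma pell_weightE i j : (0 < i)%N -> (0 < j)%N ->
  @pell_weight R i j + r ^+ 2 / j%:R = r ^+ 2 / i%:R + defect i j.
Proof.
rewrite /pell_weight /defect -!(ltr0n R) => i0 j0.
move: (i%:R : R) (j%:R : R) i0 j0 => x y x0 y0.
have -> : (y - r * x) ^+ 2 = y ^+ 2 - 2 * r * x * y + r ^+ 2 * x ^+ 2 by ring.
by rewrite silver_sq; field; rewrite !gt_eqF.
Qed.

(** [2 - r] is the conjugate root of [x^2 = 2 x + 1]; subtracting [r] times the previous term kills
    the component growing like [r^n]. *)
Lemma pell_silver n : (pell n.+1)%:R - r * (pell n)%:R = (2 - r) ^+ n.
Proof.
elim: n => [|n IH]; first by rewrite /= mulr0 subr0 expr0.
rewrite exprS -IH pellSS natrD natrM.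
move: (pell n)%:R (pell n.+1)%:R => x y.
have -> : (2 - r) * (y - r * x) = (2 - r) * y + (r ^+ 2 - 2 * r) * x by ring.
by rewrite silver_sq; ring.
Qed.

Lemma sqr_pell_silver n :
  (0 < n)%N -> ((pell n.+1)%:R - r * (pell n)%:R) ^+ 2 <= (2 - r) ^+ 2.
Proof.
case: n => // n _; have /andP[r1 r2] := silver_bounds.
rewrite pell_silver (exprS _ n) exprMn ler_piMr ?sqr_ge0 // -exprM mulnC exprM.
by rewrite exprn_ile1 ?sqr_ge0 //; nra.
Qed.

(** The numerator shrinks by [(2 - r)^2 <= 4/10], while the denominator grows at least fourfold. *)
Lemma defect_pellS n : (0 < n)%N ->
  defect (pell n.+1) (pell n.+2) <= 10^-1 * defect (pell n) (pell n.+1).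
Proof.
move=> n0; rewrite /defect !pell_silver (exprS _ n) exprMn.
have := silver_bounds => /andP[r1 r2].
have q : (2 - r) ^+ 2 <= 4 / 10 by nra.
have x0 : 0 < (pell n)%:R :> R by rewrite ltr0n pell_gt0.
have xy : 2 * (pell n)%:R <= (pell n.+1)%:R :> R.
  by rewrite -natrM ler_nat pell_geS2.
have yz : (pell n.+1)%:R <= (pell n.+2)%:R :> R by rewrite ler_nat ltnW ?pell_ltS.
move: (pell n)%:R (pell n.+1)%:R (pell n.+2)%:R x0 xy yz => x y z x0 xy yz.
have y0 : 0 < y by lra.
have z0 : 0 < z by lra.
have [s0 q0] : 0 <= ((2 - r) ^+ n) ^+ 2 /\ 0 <= (2 - r) ^+ 2 by rewrite !sqr_ge0.
move: (((2 - r) ^+ n) ^+ 2) ((2 - r) ^+ 2) s0 q q0 => s u s0 q q0.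
rewrite ler_pdivrMr ?mulr_gt0 ?exprn_gt0 //.
have -> : 10^-1 * (s / (x ^+ 2 * y)) * (y ^+ 2 * z) =
          s * (10^-1 * (y / x) ^+ 2 * (z / y)) by field; rewrite !gt_eqF.
have h1 : 2 <= y / x by rewrite ler_pdivlMr.
have h2 : 1 <= z / y by rewrite ler_pdivlMr ?mul1r.
rewrite mulrC ler_wpM2l //; apply: le_trans q _.
have h3 : 4 <= (y / x) ^+ 2 by nra.
by nra.
Qed.

(** Since [p_(n+1)] is within 43/100 of [r p_n], any other integer is at least 57/100 away from
    it. *)
Lemma defect_off_pell n j : (0 < n)%N -> (pell n < j)%N -> j != pell n.+1 ->
  10 / 9 * defect (pell n) (pell n.+1) < defect (pell n) j.
Proof.
move=> n0 nj jn; rewrite /defect.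
have := sqr_pell_silver n n0; have := silver_bounds => /andP[r1 r2] dr.
have x0 : 0 < (pell n)%:R :> R by rewrite ltr0n pell_gt0.
have y2 : 2 <= (pell n.+1)%:R :> R.
  by rewrite (ler_nat _ 2) -[2%N]/(pell 2) leq_pell.
have j0 : 0 < j%:R :> R by rewrite ltr0n; lia.
have jy : j%:R <= (pell n.+1)%:R - 1 :> R \/ (pell n.+1)%:R + 1 <= j%:R :> R.
  have [jp|pj] : (j.+1 <= pell n.+1 \/ (pell n.+1).+1 <= j)%N by lia.
    by left; rewrite lerBrDr natr1 ler_nat.
  by right; rewrite natr1 ler_nat.
move: (pell n)%:R (pell n.+1)%:R (j%:R : R) x0 y2 j0 jy dr => x y z x0 y2 z0 zy.
have -> : z - r * x = (y - r * x) + (z - y) by ring.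
move: (y - r * x) => d dr.
have d2 : d ^+ 2 <= 9 / 50 by nra.
have y0 : 0 < y by apply: lt_le_trans y2.
clear r1 r2 dr.
have [d1 d3] : - (43 / 100) <= d /\ d <= 43 / 100 by split; nra.
rewrite ltr_pdivlMr ?mulr_gt0 ?exprn_gt0 //.
have -> : 10 / 9 * (d ^+ 2 / (x ^+ 2 * y)) * (x ^+ 2 * z) =
          10 / 9 * d ^+ 2 * (z / y) by field; rewrite !gt_eqF.
have zy0 : 0 <= z / y by rewrite divr_ge0 // ltW.
have zle : 10 / 9 * d ^+ 2 * (z / y) <= 5^-1 * (z / y).
  by rewrite ler_wpM2r //; lra.
apply: le_lt_trans zle _; case: zy => zy.
  have h1 : z / y <= 1 by rewrite ler_pdivrMr ?mul1r //; lra.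
  have h2 : (57 / 100) * (57 / 100) <= (- (d + (z - y))) * (- (d + (z - y))).
    by apply: ler_pM => //; lra.
  by rewrite -sqrrN expr2; lra.
(* Above [p_(n+1) >= 2] the ratio [z / y] grows only linearly in [z - y], with slope at most 1/2,
   and the square outgrows it. *)
have h1 : z / y <= 1 + (z - y) / 2.
  by rewrite ler_pdivrMr //; nra.
have h2 : (57 / 100) * (z - y - 43 / 100) <= (d + (z - y)) * (d + (z - y)).
  by apply: ler_pM => //; lra.
by rewrite expr2; lra.
Qed.

(** As [m <= 3 p_n <= 2 r p_n], the distance from [m] to [r p_n] is at most [r p_n], and
    [r^2 <= 6]. *)
Lemma defect_pell_le n m :
  (0 < n)%N -> (0 < m <= pell n.+1)%N -> defect (pell n) m <= 6 / m%:R.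
Proof.
move=> n0 /andP[m0 mn]; have := silver_bounds => /andP[r1 r2].
have x0 : 0 < (pell n)%:R :> R by rewrite ltr0n pell_gt0.
have mx : m%:R <= 3 * (pell n)%:R :> R.
  by rewrite -natrM ler_nat; apply: leq_trans mn (pell_leS3 n n0).
rewrite /defect; rewrite -(ltr0n R) in m0.
move: (pell n)%:R (m%:R : R) x0 m0 mx => x y x0 y0 yx.
rewrite invfM mulrA ler_pM2r ?invr_gt0 // ler_pdivrMr ?exprn_gt0 //.
have -> : (y - r * x) ^+ 2 = r ^+ 2 * x ^+ 2 - y * (2 * r * x - y) by ring.
have h1 : 0 <= y * (2 * r * x - y).
  rewrite mulr_ge0 ?(ltW y0) // subr_ge0 (le_trans yx) // ler_pM2r //; lra.
have h2 : r ^+ 2 * x ^+ 2 <= 6 * x ^+ 2.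
  by rewrite ler_wpM2r ?sqr_ge0 // silver_sq; lra.
lra.
Qed.

End Defect.

(** * Optimal paths compared with the Pell path *)

Section JumpSequence.
Variables (R : realType) (a : nat -> nat) (b : nat -> R).
Hypothesis hab : weight_minimizing (@pell_weight R) a b.

Lemma jump_bounds n : (2 <= n)%N -> (0 < a n < n)%N.
Proof. by case: hab => _ _ H n2; case: (H n n2) => _ /=; lia. Qed.

Lemma jump_gt0 n : (0 < n)%N -> (0 < a n)%N.
Proof.
case: n => [|[|n]] // _; first by case: hab => ->.
by have /andP[] := jump_bounds n.+2 isT.
Qed.

Lemma iter_jump_gt0 k m : (0 < m)%N -> (0 < iter k a m)%N.
Proof. by move=> m0; elim: k => //= k; apply: jump_gt0. Qed.

(** Each jump from above the fixed point 1 descends by at least one. *)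
Lemma iter_jump_addn k m :
  (0 < m)%N -> (2 <= iter k a m)%N -> (iter k a m + k <= m)%N.
Proof.
move=> m0; elim: k => [|k IH]; first by rewrite addn0.
rewrite iterS; have := iter_jump_gt0 k m m0; move: (iter k a m) IH => y IH y0.
have [y1|y2] : (y = 1 \/ 2 <= y)%N by lia.
  by rewrite y1; case: hab => ->.
by have := jump_bounds y y2; have := IH y2; lia.
Qed.

(* Up to the constant r^2, the least total defect of a path from 1 to n. *)
Definition excess (n : nat) : R := b n + silver R ^+ 2 / n%:R.

Lemma excess_jump n : (2 <= n)%N -> excess n = excess (a n) + defect R (a n) n.
Proof.
move=> n2; have /andP[a0 an] := jump_bounds n n2.
rewrite /excess -addrA -pell_weightE //; last exact: ltn_trans an.
by case: hab => _ _ /(_ n n2)[_ _ /= <- _]; ring.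
Qed.

Lemma excess_le k n :
  (0 < k)%N -> (k < n)%N -> excess n <= excess k + defect R k n.
Proof.
move=> k0 kn; rewrite /excess -addrA -pell_weightE //; last by lia.
rewrite addrA lerD2r addrC; case: hab => _ _ /(_ n)[|[_ +] _ _ _]; first by lia.
by apply; rewrite /= k0; lia.
Qed.

Lemma excess_iter_le k m : (0 < m)%N -> excess (iter k a m) <= excess m.
Proof.
move=> m0; elim: k => // k; apply: le_trans; rewrite iterS.
have := iter_jump_gt0 k m m0; move: (iter k a m) => y y0.
have [->|y2] : (y = 1 \/ 2 <= y)%N by lia.
  by case: hab => ->.
by rewrite [X in _ <= X]excess_jump // lerDl defect_ge0.
Qed.

(* 10 / 9 = 1 + 1/10 + 1/100 + ... sums the geometric decay of [defect_pellS]. *)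
Definition pell_bound (n : nat) : R :=
  excess (pell n) + 10 / 9 * defect R (pell n) (pell n.+1).

(** With [d] the defect of the step taken, the new tail is at most [10/9 * d/10 = d/9], and
    [d + d/9 = 10/9 d]. *)
Lemma pell_boundS n : (0 < n)%N -> pell_bound n.+1 <= pell_bound n.
Proof.
move=> n0; have := excess_le _ _ (pell_gt0 n n0) (pell_ltS n).
by have := defect_pellS R n n0; rewrite /pell_bound; lra.
Qed.

Lemma excess_pell_le n l :
  (0 < n)%N -> (n <= l)%N -> excess (pell l) <= pell_bound n.
Proof.
move=> n0 nl; have := defect_ge0 R (pell l) (pell l.+1).
suff : pell_bound l <= pell_bound n by rewrite {1}/pell_bound; lra.
elim: l nl => [|l IH]; first by case: n n0.
rewrite leq_eqVlt => /orP[/eqP->//|nl].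
by apply: le_trans (IH nl); apply: pell_boundS; lia.
Qed.

(** Induction along the path from 1 to [x]: either it has met only consecutive Pell numbers, or it
    left them at [pell n], and the excess never decreases afterwards. The guard [0 < n] sets aside
    [x = 1], where [a 1 = 1] but [pell 0 = 0]. *)
Lemma pell_path_dichotomy x : (0 < x)%N ->
  (exists n, x = pell n.+1 /\ ((0 < n)%N -> a x = pell n)) \/
  (exists n, [/\ (0 < n)%N, (pell n < x)%N & pell_bound n < excess x]).
Proof.
elim/ltn_ind: x => x IH x0.
have [->|x2] : (x = 1 \/ 2 <= x)%N by lia.
  by left; exists 0%N.
have /andP[a0 ax] := jump_bounds x x2.
case: (IH _ ax a0) => [[n [an _]]|[n [n0 na lt_n]]].
  have [xn|xn] := eqVneq x (pell n.+2).
    by left; exists n.+1.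
  right; exists n.+1; split=> //; first by rewrite -an.
  rewrite (excess_jump x) // an /pell_bound ltrD2l.
  by apply: defect_off_pell => //; rewrite -an.
right; exists n; split=> //; first exact: ltn_trans ax.
by apply: lt_le_trans lt_n (excess_iter_le 1 x x0).
Qed.

(** A path that left at [pell m] would exceed [pell_bound m], which the Pell path itself
    respects. *)
Lemma jump_pell n : (0 < n)%N -> a (pell n.+1) = pell n.
Proof.
move=> n0; case: (pell_path_dichotomy (pell n.+1)) => [|[m [mn am]]|[m []]].
- exact: pell_gt0.
- by move/pell_inj: mn am => [<-]; apply.
- move=> m0; rewrite ltn_pell => /ltnW mn.
  by rewrite ltNge (excess_pell_le m).
Qed.

Lemma iter_jump_pell k n : (0 < n)%N -> iter k a (pell (n + k)) = pell n.
Proof.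
move=> n0; elim: k => [|k IH]; first by rewrite addn0.
by rewrite iterSr addnS jump_pell //; lia.
Qed.

Lemma excess_gt_pell_bound_not_core n x :
  (0 < n)%N -> (pell n < x)%N -> pell_bound n < excess x -> ~ jump_core a x.
Proof.
move=> n0 nx; rewrite -subr_gt0; set eps := _ - _ => eps0 core_x.
(* Any [m] with [iter k a m = x] satisfies [m >= k > 6 / eps], so the detour through [pell l] just
   below [m] would undercut the excess of [x]. *)
set k := Num.bound (6 / eps).
have [m m0 mx] := core_x k I.
have x2 : (2 <= x)%N by have := pell_gt0 n n0; lia.
have km : (x + k <= m)%N by rewrite -mx iter_jump_addn ?mx.
have [l [l0 lm ml]] := pell_bracket m (leq_trans (leq_trans x2 (leq_addr _ _)) km).
have nl : (n <= l)%N by rewrite -ltnS -ltn_pell; lia.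
have m_gt0 : (0 : R) < m%:R by rewrite ltr0n.
have : eps <= 6 / m%:R.
  have := excess_iter_le k m m0; rewrite mx.
  have := excess_le _ _ (pell_gt0 l l0) lm.
  have := defect_pell_le R l m l0; rewrite [(0 < m)%N]m0 ml => /(_ isT).
  by have := excess_pell_le n l n0 nl; rewrite /eps; lra.
rewrite ler_pdivlMr // mulrC -ler_pdivlMr //; apply/negP; rewrite -ltNge.
apply: lt_le_trans (archi_boundP _) _; first by rewrite divr_ge0 // ltW.
by rewrite ler_nat; apply: leq_trans km; apply: leq_addl.
Qed.

End JumpSequence.

Theorem theorem3 (R : realType) (a : nat -> nat) (b : nat -> R)
    (hab : weight_minimizing (@pell_weight R) a b) :
  jump_core a = [set pell n | n in [set n | (1 <= n)%N]].
Proof.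
apply/seteqP; split=> [x core_x|_ [n n1 <-] k _].
  (* Membership in the zeroth image only says that [x] is positive. *)
  have [m m0 mx] := core_x 0%N I; have x0 : (0 < x)%N by rewrite -mx.
  case: (pell_path_dichotomy _ _ _ hab x x0) => [[n [-> _]]|[n [n0 nx lt_n]]].
    by exists n.+1.
  by case: (excess_gt_pell_bound_not_core _ _ _ hab n x n0 nx lt_n core_x).
exists (pell (n + k)); last exact: iter_jump_pell hab _ _ n1.
by apply: pell_gt0; rewrite addn_gt0 [(0 < n)%N]n1.
Qed.
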